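(* Let $G$ be a connected graph with maximum degree $\Delta(G)$, and let $\pi$ be a $prc$-partition of $G$. If $A\in\pi$, then $A$ forms a perfect coalition with at most $\Delta(G)$ members of $\pi$. Further, this bound is sharp: for every $\Delta\geq 2$ there exist a connected graph $G_\Delta$ with maximum degree $\Delta$ and a $prc$-partition of $G_\Delta$ containing a set that forms a perfect coalition with exactly $\Delta$ members of the partition.
   Context: All graphs are simple, finite and undirected. A set $S\subseteq V(G)$ is a dominating set if every vertex not in $S$ has a neighbor in $S$; $S$ is a perfect dominating set if every vertex in $V(G)\setminus S$ has exactly one neighbor in $S$. A perfect coalition in $G$ consists of two disjoint sets $V_1,V_2$ of vertices such that (i) neither $V_1$ nor $V_2$ is a dominating set of $G$; (ii) each vertex in $V(G)\setminus V_1$ has at most one neighbor in $V_1$, and each vertex in $V(G)\setminus V_2$ has at most one neighbor in $V_2$; (iii) $V_1\cup V_2$ is a perfect dominating set of $G$. A perfect coalition partition ($prc$-partition) of $G$ is a vertex partition $\pi=\{V_1,\dots,V_k\}$ such that each $V_i$ either is a singleton dominating set or forms a perfect coalition with some $V_j\in\pi$. *)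

(* Defs.v *)
From mathcomp Require Import all_boot.

Set Implicit Arguments.
Unset Strict Implicit.
Unset Printing Implicit Defensive.

Record sgraph := SGraph {
  vertex :> finType;
  adj : rel vertex;
  adj_sym : symmetric adj;
  adj_irrefl : irreflexive adj
}.

Section Coalitions.
Variable G : sgraph.
Implicit Types (x y : G) (S A B : {set G}) (P : {set {set G}}).

Definition neighbors x : {set G} := [set y | adj x y].

Definition max_degree : nat := \max_(x : G) #|neighbors x|.

Definition connected_graph : Prop := forall x y, connect (@adj G) x y.

Definition dominating S : bool :=
  [forall x, (x \notin S) ==> [exists y in S, adj x y]].

Definition perfect_dominating S : bool :=
  [forall x, (x \notin S) ==> (#|neighbors x :&: S| == 1)].

Definition at_most_one_neighbor S : bool :=
  [forall x, (x \notin S) ==> (#|neighbors x :&: S| <= 1)].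

Definition perfect_coalition A B : bool :=
  [&& [disjoint A & B],
      ~~ dominating A, ~~ dominating B,
      at_most_one_neighbor A, at_most_one_neighbor B
    & perfect_dominating (A :|: B)].

Definition prc_partition P : bool :=
  partition P [set: G] &&
  [forall A in P,
     ((#|A| == 1) && dominating A) || [exists B in P, perfect_coalition A B]].

Definition coalition_partners P A : {set {set G}} :=
  [set B in P | perfect_coalition A B].

End Coalitions.

Arguments connected_graph G : clear implicits.
Arguments max_degree G : clear implicits.

(* Main.v *)
Require Import Defs.
From mathcomp Require Import all_boot.

Set Implicit Arguments.
Unset Strict Implicit.
Unset Printing Implicit Defensive.

(** Upper bound: let [x] be neither in [A] nor adjacent to [A].  Every partner of
    [A] meets the closed neighborhood [N[x]], so there are at most [Delta + 1] of
    them.  If there were [Delta + 1], then [N[x]] would be a transversal of the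
    partners.  As [A] together with the partner containing [x] is perfect
    dominating, a neighbor [y] of [x] sees only [x] in it, so [y] is not dominated
    by [A] either.  By connectedness no vertex is dominated by [A], so [A] would be
    empty.

    Sharpness: attach to each vertex [x_i] of the complete graph on [Delta]
    vertices a neighbor [y_i], and join all the [y_i] to one further vertex [a].
    Then [{a}] forms a perfect coalition with each of the [{x_i, y_i}]. *)

(** * The upper bound: counting partners through a closed neighborhood *)

Section UpperBound.
Variables (G : sgraph) (P : {set {set G}}) (A : {set G}).

Definition undominated (x : G) : bool :=
  (x \notin A) && (neighbors x :&: A == set0).

Definition closed_neighbors (x : G) : {set G} := x |: neighbors x.

Lemma dominatingPn : reflect (exists x, undominated x) (~~ dominating A).
Proof.
apply: (iffP forallPn) => -[x].
  rewrite negb_imply => /andP[xA /existsPn noA]; exists x.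
  rewrite /undominated xA; apply/eqP/setP => y; rewrite !inE andbC.
  exact: negbTE (noA y).
move=> /andP[xA /eqP noA]; exists x; rewrite negb_imply xA /=.
apply/existsPn => y; apply/negP => /andP[yA xy].
by have := in_set0 y; rewrite -noA !inE xy yA.
Qed.

(** If [x] lies outside [B], its unique neighbor in [A :|: B] cannot be in [A], hence is in [B]. *)
Lemma partner_meets_closed_neighbors x (B : {set G}) :
  undominated x -> perfect_coalition A B ->
  exists2 z, z \in closed_neighbors x & z \in B.
Proof.
move=> /andP[xA /eqP noA] /and5P[_ _ _ _ /andP[_ /forallP /(_ x)]].
have [xB _|xB] := boolP (x \in B); first by exists x => //; rewrite setU11.
rewrite inE negb_or xA xB /= => /cards1P[z Nz].
have := set11 z; rewrite -Nz in_setI => /andP[xz].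
rewrite inE => /orP[zA|zB]; last by exists z; rewrite // inE xz orbT.
by have := in_set0 z; rewrite -noA in_setI xz zA.
Qed.

Lemma card_closed_neighbors x : #|closed_neighbors x| <= (max_degree G).+1.
Proof.
rewrite /closed_neighbors cardsU1 -add1n leq_add ?leq_b1 //.
exact: (leq_bigmax x).
Qed.

Hypothesis partP : partition P [set: G].

Lemma partners_sub_pblocks x :
  undominated x ->
  coalition_partners P A \subset pblock P @: closed_neighbors x.
Proof.
move=> ux; apply/subsetP => B; rewrite inE => /andP[BP cAB].
have [z zN zB] := partner_meets_closed_neighbors ux cAB.
apply/imsetP; exists z => //; apply/esym/def_pblock => //.
by case/and3P: partP.
Qed.

(** This is the propagation step: with more than [max_degree G] partners, [pblock P] is a bijection
    from the closed neighborhood of [x] onto the partners. *)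
Lemma undominated_adj x y :
  max_degree G < #|coalition_partners P A| ->
  undominated x -> adj x y -> undominated y.
Proof.
move=> gtD ux xy.
have sub := partners_sub_pblocks ux.
have leN := leq_trans (card_closed_neighbors x) gtD.
have leI := leq_imset_card (pblock P) (closed_neighbors x).
(* The sizes of the partner set, the image and the closed neighborhood increase weakly in this
   order, and [leN] closes the cycle, so all are equal. *)
have /eqP eqQ : coalition_partners P A == pblock P @: closed_neighbors x.
  by rewrite eqEcard sub (leq_trans leI).
have /imset_injP inj : #|pblock P @: closed_neighbors x| == #|closed_neighbors x|.
  by rewrite eqn_leq leI -eqQ leN.
have xN : x \in closed_neighbors x by rewrite setU11.
have yN : y \in closed_neighbors x by rewrite !inE xy orbT.
have [_ trivP _] := and3P partP.
have covP z : z \in cover P by rewrite (cover_partition partP) inE.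
have part z : z \in closed_neighbors x -> perfect_coalition A (pblock P z).
  by move=> /(imset_f (pblock P)); rewrite -eqQ inE => /andP[].
have yA : y \notin A.
  by have /and5P[/disjointFl -> //] := part _ yN; rewrite mem_pblock.
(* Injectivity separates the blocks of [x] and [y]; then [x] is the only neighbor of [y] in
   [A :|: pblock P x]. *)
have yBx : y \notin pblock P x.
  rewrite -eq_pblock //; apply/eqP => /(inj _ _ xN yN) exy.
  by rewrite exy adj_irrefl in xy.
have /and5P[dis _ _ _ /andP[_ /forallP /(_ y)]] := part _ xN.
rewrite inE negb_or yA yBx /= => /cards1P[z Nz].
have xBx : x \in pblock P x by rewrite mem_pblock.
have xz : x = z by apply/set1P; rewrite -Nz !inE adj_sym xy xBx orbT.
rewrite /undominated yA; apply/eqP/setP => w; rewrite in_setI in_set0.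
apply/negP => /andP[yw wA].
have : w \in [set z] by rewrite -Nz in_setI yw inE wA.
by rewrite -xz => /set1P wx; move: wA; rewrite wx (disjointFl dis).
Qed.

Lemma card_coalition_partners :
  connected_graph G -> A \in P -> #|coalition_partners P A| <= max_degree G.
Proof.
move=> conG AP; rewrite leqNgt; apply/negP => gtD.
have /card_gt0P[B] : 0 < #|coalition_partners P A| by apply: leq_trans gtD.
rewrite inE => /andP[_ /and5P[_ /dominatingPn[x ux] _ _ _]].
have [_ _ notP0] := and3P partP.
have /set0Pn[a aA] : A != set0 by apply: contraNneq notP0 => <-.
have /connectP[p pp ea] := conG x a.
(* Being undominated spreads along a path from [x] to [a], although [a] is in [A]. *)
suff : undominated a by rewrite /undominated aA.
rewrite {}ea; elim: p x ux pp => //= y p IHp x ux /andP[xy].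
exact/IHp/(undominated_adj gtD ux xy).
Qed.

End UpperBound.

Lemma perfect_coalition_sym (G : sgraph) (A B : {set G}) :
  perfect_coalition A B = perfect_coalition B A.
Proof.
rewrite /perfect_coalition disjoint_sym setUC.
by case: (dominating A); case: (dominating B);
   case: (at_most_one_neighbor A); case: (at_most_one_neighbor B).
Qed.

(** * Sharpness: the extremal graph *)

Section Sharpness.
Variable D : nat.
Hypothesis D_ge2 : 2 <= D.

(* [a] is [None], [x_i] is [Some (true, i)] and [y_i] is [Some (false, i)]. *)
Definition sun_vertex : finType := option (bool * 'I_D).

Definition sun_adj : rel sun_vertex := fun u v =>
  match u, v with
  | None, None => false
  | None, Some (b, _) | Some (b, _), None => ~~ b
  | Some (b, i), Some (c, j) => if i == j then b != c else b && c
  end.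

Lemma sun_adj_sym : symmetric sun_adj.
Proof.
by move=> [[b i]|] [[c j]|] //=; rewrite [i == j]eq_sym [b == c]eq_sym andbC.
Qed.

Lemma sun_adj_irrefl : irreflexive sun_adj.
Proof. by move=> [[b i]|] //=; rewrite !eqxx. Qed.

Definition sun : sgraph := SGraph sun_adj_sym sun_adj_irrefl.

Definition sun_index (v : sun) : option 'I_D := omap snd v.

(** As fibers of [sun_index], the blocks are [{a}] for [None] and [{x_i, y_i}] for [Some i]. *)
Definition sun_block (k : option 'I_D) : {set sun} := [set v | sun_index v == k].

Definition sun_partition : {set {set sun}} := [set sun_block k | k : option 'I_D].

Lemma ord_neq (i : 'I_D) : exists j, j != i.
Proof.
have : 0 < #|predC1 i| by rewrite cardC1 card_ord; case: D D_ge2 => [|[]].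
by case/card_gt0P => j ji; exists j.
Qed.

Lemma sun_index_surj k : exists v, sun_index v = k.
Proof. by case: k => [i|]; [exists (Some (true, i)) | exists None]. Qed.

Lemma sun_block_inj : injective sun_block.
Proof.
move=> k l /setP ekl; have [v vk] := sun_index_surj k.
by have := ekl v; rewrite !inE vk eqxx => /esym/eqP.
Qed.

Lemma sun_partitionP : partition sun_partition [set: sun].
Proof.
apply/and3P; split.
- rewrite eqEsubset subsetT; apply/subsetP => v _.
  by apply/bigcupP; exists (sun_block (sun_index v)); rewrite ?imset_f ?inE.
- apply/trivIsetP => _ _ /imsetP[k _ ->] /imsetP[l _ ->] neq.
  rewrite -setI_eq0; apply/eqP/setP => v; rewrite !inE.
  by apply: contraNF neq => /andP[/eqP <- /eqP <-].
- apply/imsetP => -[k _ /setP e0]; have [v vk] := sun_index_surj k.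
  by have := e0 v; rewrite !inE vk eqxx.
Qed.

Lemma sun_block_coalition i : perfect_coalition (sun_block None) (sun_block (Some i)).
Proof.
have [j ji] := ord_neq i.
have ij : (i == j) = false by rewrite eq_sym (negbTE ji).
apply/and5P; split; last (apply/andP; split).
- rewrite -setI_eq0; apply/eqP/setP => v; rewrite !inE.
  by case: (sun_index v).
(* The vertex [x_i] is not adjacent to [a]. *)
- apply/forallPn; exists (Some (true, i)); rewrite negb_imply !inE /=.
  by apply/existsPn => -[[b k]|]; rewrite !inE.
(* The neighbors of [y_j] are [a] and [x_j], both outside block [i] as [j != i]. *)
- apply/forallPn; exists (Some (false, j)); rewrite negb_imply !inE /=.
  rewrite (inj_eq Some_inj) ji.
  apply/existsPn => -[[b k]|]; rewrite !inE //=.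
  by rewrite (inj_eq Some_inj); case: (k =P i) => //= ->; rewrite (negbTE ji).
- apply/forallP => v; apply/implyP => _.
  rewrite -(cards1 (None : sun)); apply/subset_leq_card/subsetP.
  by move=> [[b k]|]; rewrite !inE //= andbF.
- apply/forallP => v; apply/implyP; rewrite inE => vi.
  (* The only possible neighbor of [v] in the block is [y_i] if [v] is [a], and [x_i] otherwise. *)
  rewrite -(cards1 (Some (v != None, i) : sun)); apply/subset_leq_card/subsetP.
  move=> [[b k]|]; rewrite !inE //= ?andbF // (inj_eq Some_inj) => /andP[vk /eqP ek].
  rewrite {k}ek in vk *; case: v vi vk => [[c k]|] /=.
    by rewrite (inj_eq Some_inj) => /negbTE -> /andP[_ ->].
  by move=> _ /negbTE->.
- apply/forallP => v; apply/implyP; rewrite !inE negb_or => /andP[v0 vi].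
  case: v v0 vi => [[c k]|] //= _; rewrite (inj_eq Some_inj) => /negbTE ki.
  (* For [k != i], [x_k] sees only [x_i] in the union, and [y_k] sees only [a]. *)
  apply/cards1P; exists (if c then Some (true, i) else None : sun).
  apply/setP => -[[b l]|]; rewrite !inE /=; last by case: c.
  rewrite (inj_eq Some_inj); case: c; rewrite ?(inj_eq Some_inj) ?xpair_eqE.
    by case: (l =P i) => [->|]; rewrite ?ki ?andbT ?andbF; case: b.
  by case: (l =P i) => [->|]; rewrite ?ki ?andbF.
Qed.

(** Partners range over the whole partition, so [{a}] itself has to be ruled out: a nonempty block
    is not disjoint from itself. *)
Lemma sun_block_self k : ~~ perfect_coalition (sun_block k) (sun_block k).
Proof.
have [v vk] := sun_index_surj k; apply/negP => /andP[/disjointFl dis _].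
by have := dis v; rewrite inE vk eqxx => /(_ isT).
Qed.

Lemma sun_prc : prc_partition sun_partition.
Proof.
rewrite /prc_partition sun_partitionP.
apply/forallP => S; apply/implyP => /imsetP[k _ ->]; apply/orP; right.
case: k => [i|]; apply/existsP.
  exists (sun_block None).
  by rewrite imset_f // perfect_coalition_sym sun_block_coalition.
exists (sun_block (Some (Ordinal (ltnW D_ge2)))).
by rewrite imset_f // sun_block_coalition.
Qed.

Lemma sun_partners :
  coalition_partners sun_partition (sun_block None) =
  [set sun_block (Some i) | i : 'I_D].
Proof.
apply/setP => S; rewrite inE; apply/andP/imsetP.
  move=> [/imsetP[[i|] _ ->] cS]; first by exists i.
  by rewrite (negbTE (sun_block_self None)) in cS.
by move=> [i _ ->]; rewrite imset_f ?sun_block_coalition.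
Qed.

Lemma sun_connected : connected_graph sun.
Proof.
have sym : connect_sym (@adj sun) := sym_connect_sym sun_adj_sym.
have toN u : connect (@adj sun) None u.
  have y i : connect (@adj sun) None (Some (false, i)) by apply/connect1.
  case: u => [[[] i]|] //; apply: connect_trans (y i) _; apply/connect1.
  by rewrite /= eqxx.
by move=> u v; apply: connect_trans (toN v); rewrite sym.
Qed.

Lemma sun_max_degree : max_degree sun = D.
Proof.
have card_y : #|neighbors (None : sun)| = D.
  have -> : neighbors (None : sun) = [set Some (false, i) | i : 'I_D].
    apply/setP => u; rewrite !inE; apply/idP/imsetP => [|[i _ ->] //].
    by case: u => [[[] i]|] // _; exists i.
  by rewrite card_imset ?card_ord // => i j [].
apply/eqP; rewrite eqn_leq; apply/andP; split; last first.
  by rewrite -[leqLHS]card_y; apply: (leq_bigmax (None : sun)).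
apply/bigmax_leqP => -[[[] i]|] _; last by rewrite card_y.
(* The neighbors of [x_i] are indexed by [j]: [x_j] for [j != i], and [y_i] for [j = i]. *)
- have sub : neighbors (Some (true, i) : sun) \subset
             [set Some (j != i, j) | j : 'I_D].
    apply/subsetP => -[[b j]|]; rewrite !inE //= => ij.
    apply/imsetP; exists j => //; rewrite eq_sym; move: ij.
    by case: (i =P j) => _; case: b.
  apply: leq_trans (subset_leq_card sub) _.
  by apply: leq_trans (leq_imset_card _ _) _; rewrite card_ord.
(* Each [y_i] has degree at most 2, which is where [D_ge2] bounds the degree. *)
- apply: leq_trans D_ge2.
  have sub : neighbors (Some (false, i) : sun) \subset
             [set None; Some (true, i)].
    apply/subsetP => -[[b j]|]; rewrite !inE //=.
    by case: (i =P j) => // ->; case: b; rewrite ?eqxx.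
  by apply: leq_trans (subset_leq_card sub) _; rewrite cards2.
Qed.

End Sharpness.

Theorem theorem2p3 :
  (forall (G : sgraph) (P : {set {set G}}) (A : {set G}),
     connected_graph G -> prc_partition P -> A \in P ->
     #|coalition_partners P A| <= max_degree G) /\
  (forall Delta : nat, 2 <= Delta ->
     exists (G : sgraph) (P : {set {set G}}) (A : {set G}),
       [/\ connected_graph G, max_degree G = Delta, prc_partition P,
           A \in P & #|coalition_partners P A| = Delta]).
Proof.
split=> [G P A conG /andP[partP _] AP|D D_ge2].
  exact: card_coalition_partners.
exists (sun D), (sun_partition D), (@sun_block D None); split.
- exact: sun_connected.
- exact: sun_max_degree.
- exact: sun_prc.
- exact: imset_f.
- rewrite sun_partners // card_imset ?card_ord // => i j.
  by move/sun_block_inj => [].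
Qed.
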